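(* Let $d\ge 1$ and let $v=v_1\cdots v_d$ and $w=w_1\cdots w_d$ be two permutations in $\mathcal{S}_d$ (viewed as patterns). Suppose that $\mathcal{O}_v=\mathcal{O}_w$ and that for every $i\in\mathcal{O}_v$, $$\{v_1,\dots,v_{d-i}\}=\{w_1,\dots,w_{d-i}\}\quad\text{and}\quad \{v_{i+1},\dots,v_d\}=\{w_{i+1},\dots,w_d\}.$$ Then $v$ and $w$ are strongly c-Wilf-equivalent in words (and in particular c-Wilf-equivalent in words), i.e. $g_r^v([k]^n)=g_r^w([k]^n)$ for all $k,n\in\mathbb{N}$ and all $r\in\mathbb{N}_0$.
   Context: For $k\in\mathbb{N}$, $[k]=\{1,\dots,k\}$ and $[k]^n$ is the set of words $u=u_1\cdots u_n$ of length $n$ with letters in $[k]$. For $v\in\mathcal{S}_d$ and a word $u$, a consecutive occurrence of $v$ in $u$ is an index $j$ with $1\le j\le n-d+1$ such that $u_j u_{j+1}\cdots u_{j+d-1}$ is order-isomorphic to $v$, i.e. for all $1\le p,q\le d$: $u_{j+p-1}<u_{j+q-1}\iff v_p<v_q$ and $u_{j+p-1}=u_{j+q-1}\iff v_p=v_q$. Let $\mathrm{con}_v(u)$ be the number of consecutive occurrences of $v$ in $u$, and $g_r^v([k]^n)=\#\{u\in[k]^n:\mathrm{con}_v(u)=r\}$. The overlap set $\mathcal{O}_v$ is the set of indices $i$ with $1\le i<d$ such that $v_1\cdots v_i$ and $v_{d-i+1}\cdots v_d$ are order-isomorphic. Two patterns $v,w$ are c-Wilf-equivalent in words if $g_0^v([k]^n)=g_0^w([k]^n)$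 for all $k,n\in\mathbb{N}$, and strongly c-Wilf-equivalent in words if $g_r^v([k]^n)=g_r^w([k]^n)$ for all $k,n\in\mathbb{N}$ and $r\in\mathbb{N}_0$. *)

(* Defs.v *)
(* Conventions: indices, letters and values are 0-based.  The
   alphabet {1..k} is 'I_k, a word of length n is a tuple in n.-tuple 'I_k, and
   a permutation of S_d is v : 'S_d, whose one-line notation is
   v 0, ..., v (d-1).  Only the shift by 1 distinguishes these from the usual
   1-based objects; lengths, the overlap indices and counts are not shifted. *)
From mathcomp Require Import all_boot all_fingroup.

Set Implicit Arguments.
Unset Strict Implicit.
Unset Printing Implicit Defensive.

Definition order_iso (s t : seq nat) : bool :=
  (size s == size t) &&
  [forall p : 'I_(size s), forall q : 'I_(size s),
     ((nth 0 s p < nth 0 s q) == (nth 0 t p < nth 0 t q)) &&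
     ((nth 0 s p == nth 0 s q) == (nth 0 t p == nth 0 t q))].

Definition one_line (d : nat) (v : 'S_d) : seq nat :=
  [seq nat_of_ord (v i) | i <- enum 'I_d].

Definition letters (k n : nat) (u : n.-tuple 'I_k) : seq nat :=
  [seq nat_of_ord a | a <- u].

(* For d > 0 every starting position j with j + d <= n satisfies j < n, so
   'I_n contains all of them. *)
Definition con (d : nat) (v : 'S_d) (k n : nat) (u : n.-tuple 'I_k) : nat :=
  #|[set j : 'I_n | (j + d <= n) &&
       order_iso (take d (drop j (letters u))) (one_line v)]|.

Definition g (d : nat) (v : 'S_d) (k n r : nat) : nat :=
  #|[set u : n.-tuple 'I_k | con v u == r]|.

(* The index i is the common length of the order-isomorphic prefix and
   suffix; it ranges over 0 < i < d. *)
Definition overlap_set (d : nat) (v : 'S_d) : {set 'I_d} :=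
  [set i : 'I_d | (0 < i) &&
     order_iso (take i (one_line v)) (drop (d - i) (one_line v))].

Definition prefix_values (d : nat) (v : 'S_d) (m : nat) : {set 'I_d} :=
  [set v p | p : 'I_d & p < m].

(* The values of v remaining after its first m entries are dropped. *)
Definition suffix_values (d : nat) (v : 'S_d) (m : nat) : {set 'I_d} :=
  [set v p | p : 'I_d & m <= p].

Definition c_Wilf_equiv (d : nat) (v w : 'S_d) : Prop :=
  forall k n : nat, 0 < k -> 0 < n -> g v k n 0 = g w k n 0.

Definition strongly_c_Wilf_equiv (d : nat) (v w : 'S_d) : Prop :=
  forall k n r : nat, 0 < k -> 0 < n -> g v k n r = g w k n r.

(* Main.v *)
(* For a set S of starting positions, the words with v at every position of S
   and those with w at every position of S are equinumerous: replacing, inside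
   every window of S, the pattern v by w on the same set of letters amounts to
   permuting the positions of the window by v^-1 w.  The hypotheses on the
   overlaps say exactly that these rearrangements agree wherever two windows
   meet, so they glue to a permutation of all positions of the word.
   Inclusion-exclusion over S then gives the distribution of con. *)
Require Import Defs.
From mathcomp Require Import all_boot all_fingroup.
From mathcomp Require Import zify.

Set Implicit Arguments.
Unset Strict Implicit.
Unset Printing Implicit Defensive.

(** * Order isomorphism and functions determined by their order *)

Lemma order_isoP (s t : seq nat) :
  reflect (size s = size t /\
           forall p q, p < size s -> q < size s ->
             (nth 0 s p < nth 0 s q) = (nth 0 t p < nth 0 t q))
          (order_iso s t).
Proof.
apply: (iffP andP) => [[/eqP st /forallP H]|[st H]]; split=> //.
- move=> p q ps qs.
  by move/forallP: (H (Ordinal ps)) => /(_ (Ordinal qs))/andP[/eqP].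
- exact/eqP.
apply/forallP => p; apply/forallP => q; rewrite !H ?eqxx //=.
(* By trichotomy, equality of two entries is read off from the strict comparisons in both
   directions. *)
move: (H p q (ltn_ord p) (ltn_ord q)) (H q p (ltn_ord q) (ltn_ord p)).
by case: ltngtP => _; case: ltngtP => _ //.
Qed.

(** Induct on the smaller of the two values. If f p < h p, then f p = h q for some q; since h q < h
    p, also f q < f p, and induction at q gives f q = h q = f p, a contradiction. *)
Lemma order_eq_image (P : pred nat) (f h : nat -> nat) :
  {in P &, forall p q, (f p < f q) = (h p < h q)} ->
  {in P, forall p, exists2 q, q \in P & f p = h q} ->
  {in P, forall p, exists2 q, q \in P & h p = f q} ->
  {in P, f =1 h}.
Proof.
move=> fh f_h h_f p; have [m] := ubnP (minn (f p) (h p)).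
elim: m p => // m IHm p lt_m Pp.
case: (ltngtP (f p) (h p)) => // lt_fh.
- have [q Pq fp] := f_h p Pp.
  have lt_q : f q < f p by rewrite fh // -fp.
  have := IHm q; lia.
- have [q Pq hp] := h_f p Pp.
  have lt_q : h q < h p by rewrite -fh // -hp.
  have := IHm q; lia.
Qed.

(** * Sieving over sets *)

Lemma eq_card_fibers (T : finType) (I : finType) (F G : T -> {set I}) :
  (forall S : {set I}, #|[set u | S \subset F u]| = #|[set u | S \subset G u]|) ->
  forall S, #|[set u | F u == S]| = #|[set u | G u == S]|.
Proof.
move=> eqFG.
have split_card (H : T -> {set I}) (S : {set I}) : #|[set u | S \subset H u]| =
    #|[set u | H u == S]| + \sum_(X : {set I} | S \proper X) #|[set u | H u == X]|.
  rewrite -sum1_card (partition_big H (fun X : {set I} => S \subset X)) => [|u]; last first.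
    by rewrite inE.
  rewrite (bigD1 S) //=; congr (_ + _).
    rewrite -sum1_card; apply: eq_bigl => u; rewrite !inE.
    by case: eqP => [->|]; rewrite ?subxx ?andbF.
  apply: eq_big => [X|X /andP[sSX _]]; first by rewrite properEneq eq_sym andbC.
  rewrite -sum1_card; apply: eq_bigl => u; rewrite !inE.
  by case: eqP => [->|]; rewrite ?sSX ?andbF.
(* Downward induction on the size of [S]: the fibres over strictly larger sets agree already, so
   cancelling them from both sums leaves the fibres over [S]. *)
move=> S; have [m] := ubnP (#|I| - #|S|); elim: m S => // m IHm S ltSm.
have := eqFG S; rewrite !split_card.
rewrite [in X in X = _](eq_bigr (fun X => #|[set u | G u == X]|)).
  exact: addIn.
move=> X /proper_card ltSX; apply: IHm.
by have := subset_leq_card (subsetT X); rewrite cardsT; lia.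
Qed.

(** * Transferring positions between two arrangements of the same letters *)

(** This is s^-1 t acting on positions. Working in [nat] allows positions to be shifted by an offset
    freely. *)
Definition transfer (s t : seq nat) (p : nat) : nat := index (nth 0 t p) s.

Section Transfer.

Variables s t : seq nat.
Hypotheses (s_uniq : uniq s) (t_uniq : uniq t) (eq_st : s =i t).

Let size_st : size s = size t.
Proof. by apply/eqP; rewrite eq_sym -(uniq_size_uniq s_uniq eq_st). Qed.

Lemma transfer_lt p : p < size t -> transfer s t p < size t.
Proof. by move=> lt_p; rewrite -size_st index_mem eq_st mem_nth. Qed.

Lemma nth_transfer p : p < size t -> nth 0 s (transfer s t p) = nth 0 t p.
Proof. by move=> lt_p; rewrite nth_index // eq_st mem_nth. Qed.

Lemma transferK p : p < size s -> transfer s t (transfer t s p) = p.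
Proof.
by move=> lt_p; rewrite /transfer nth_index ?index_uniq // -eq_st mem_nth.
Qed.

(** Compare p -> s_(transfer p + e) with p -> t_(p + e) for p < size s - e. The two self-overlaps
    pull both orders back to that of s_(transfer p) = t_p, and the images agree because the suffixes
    share their letters. So [order_eq_image] identifies the two maps. *)
Lemma transfer_shift e :
    order_iso (take (size s - e) s) (drop e s) ->
    order_iso (take (size s - e) t) (drop e t) ->
    take (size s - e) s =i take (size s - e) t -> drop e s =i drop e t ->
  forall p, p + e < size s -> transfer s t (p + e) = transfer s t p + e.
Proof.
set i := size s - e => /order_isoP[_ ov_s] /order_isoP[_ ov_t] eq_take eq_drop.
have size_i (r : seq nat) : size r = size s -> size (take i r) = i.
  by move=> sr; rewrite size_take_min sr; apply/minn_idPl/leq_subr.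
have size_e (r : seq nat) : size r = size s -> size (drop e r) = i.
  by move=> sr; rewrite size_drop sr.
have size_ts : size t = size s by [].
(* The prefixes share their letters, so [transfer] maps the first i positions to themselves. *)
have tr_i p : p < i -> transfer s t p < i.
  move=> lt_p; have : nth 0 t p \in take i s.
    by rewrite eq_take -(nth_take 0 lt_p) mem_nth // size_i.
  move=> /(nthP 0)[q]; rewrite size_i // => lt_q; rewrite nth_take // => tp.
  by rewrite /transfer -tp index_uniq // (leq_trans lt_q (leq_subr _ _)).
have nth_dropD (r : seq nat) q : nth 0 (drop e r) q = nth 0 r (q + e).
  by rewrite nth_drop addnC.
have ov_nth (r : seq nat) : size r = size s ->
    (forall p q, p < size (take i r) -> q < size (take i r) ->
       (nth 0 (take i r) p < nth 0 (take i r) q) =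
       (nth 0 (drop e r) p < nth 0 (drop e r) q)) ->
    forall p q, p < i -> q < i ->
      (nth 0 r p < nth 0 r q) = (nth 0 r (p + e) < nth 0 r (q + e)).
  move=> sr ov p q lt_p lt_q.
  by have := ov p q; rewrite size_i // !nth_take // !nth_dropD; apply.
have i_lt p : p < i -> p < size t /\ p + e < size t.
  by rewrite size_ts /i; lia.
have eq_fh : {in gtn i, (fun p => nth 0 s (transfer s t p + e)) =1
                         (fun p => nth 0 t (p + e))}.
  apply: order_eq_image => [p q|p|p]; rewrite -!topredE /=.
  - move=> lt_p lt_q; rewrite -(ov_nth t) // -(ov_nth s) ?tr_i //.
    by rewrite !nth_transfer; case: (i_lt p) => //; case: (i_lt q).
  - move=> lt_p; have : nth 0 s (transfer s t p + e) \in drop e t.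
      by rewrite -eq_drop -nth_dropD mem_nth // size_e // tr_i.
    move=> /(nthP 0)[q]; rewrite size_e // => lt_q; rewrite nth_dropD => <-.
    by exists q.
  - move=> lt_p; have : nth 0 t (p + e) \in drop e s.
      by rewrite eq_drop -nth_dropD mem_nth // size_e.
    move=> /(nthP 0)[r]; rewrite size_e // => lt_r; rewrite nth_dropD => <-.
    (* With t_(p + e) = s_(r + e), the witness is the q < i such that t_q = s_r, which
       [transfer s t] sends to r. *)
    have : nth 0 s r \in take i t.
      by rewrite -eq_take -(nth_take 0 lt_r) mem_nth // size_i.
    move=> /(nthP 0)[q]; rewrite size_i // => lt_q; rewrite nth_take // => tq.
    exists q => //; rewrite /transfer tq index_uniq //.
    by case: (i_lt r) => //; rewrite size_ts.
move=> p lt_p; have lt_pi : p < i by rewrite /i; lia.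
have lt_tr : transfer s t p + e < size s.
  by have := tr_i p lt_pi; rewrite /i; lia.
by rewrite {1}/transfer -(eq_fh p) // index_uniq.
Qed.

End Transfer.

(** * One-line notation and its prefix and suffix values *)

Section OneLine.

Variable d : nat.
Implicit Types v w : 'S_d.

Lemma size_one_line v : size (one_line v) = d.
Proof. by rewrite size_map size_enum_ord. Qed.

Lemma one_line_uniq v : uniq (one_line v).
Proof.
by rewrite map_inj_uniq ?enum_uniq // => i j /val_inj/perm_inj.
Qed.

Lemma nth_one_line v (i : 'I_d) : nth 0 (one_line v) i = v i.
Proof. by rewrite (nth_map i) ?size_enum_ord // nth_ord_enum. Qed.

Lemma one_line_mem v w : one_line v =i one_line w.
Proof.
have sub v' w' x : x \in one_line v' -> x \in one_line w'.
  move=> /mapP[i _ ->]; apply/mapP; exists ((w'^-1)%g (v' i)).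
    by rewrite mem_enum.
  by rewrite permKV.
by move=> x; apply/idP/idP; apply: sub.
Qed.

Lemma mem_take_one_line v m (x : 'I_d) :
  (nat_of_ord x \in take m (one_line v)) = (x \in prefix_values v m).
Proof.
apply/idP/imsetP => [/(nthP 0)[p]|[p]].
  rewrite size_take_min size_one_line leq_min => /andP[ltpm ltpd].
  rewrite nth_take // -[p]/(nat_of_ord (Ordinal ltpd)) nth_one_line.
  by move=> /val_inj<-; exists (Ordinal ltpd); rewrite ?inE.
rewrite inE => ltpm ->; rewrite -nth_one_line -(nth_take 0 ltpm) mem_nth //.
by rewrite size_take_min size_one_line leq_min ltpm /=.
Qed.

Lemma mem_drop_one_line v m (x : 'I_d) :
  (nat_of_ord x \in drop m (one_line v)) = (x \in suffix_values v m).
Proof.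
apply/idP/imsetP => [/(nthP 0)[p]|[p]].
  rewrite size_drop size_one_line nth_drop => ltp.
  have ltpd : m + p < d by lia.
  rewrite -[m + p]/(nat_of_ord (Ordinal ltpd)) nth_one_line => /val_inj<-.
  by exists (Ordinal ltpd) => //; rewrite inE leq_addr.
rewrite inE => lemp ->; rewrite -nth_one_line -(subnKC lemp) -nth_drop mem_nth //.
by rewrite size_drop size_one_line ltn_sub2r // (leq_ltn_trans lemp).
Qed.

Lemma one_line_ltn v x : x \in one_line v -> x < d.
Proof. by move=> /mapP[i _ ->]. Qed.

Lemma eq_take_one_line v w m :
  prefix_values v m = prefix_values w m ->
  take m (one_line v) =i take m (one_line w).
Proof.
move=> eq_vw x; case: (ltnP x d) => [ltxd|lexd].
  by rewrite -[x]/(nat_of_ord (Ordinal ltxd)) !mem_take_one_line eq_vw.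
by apply/idP/idP => /mem_take/one_line_ltn; lia.
Qed.

Lemma eq_drop_one_line v w m :
  suffix_values v m = suffix_values w m ->
  drop m (one_line v) =i drop m (one_line w).
Proof.
move=> eq_vw x; case: (ltnP x d) => [ltxd|lexd].
  by rewrite -[x]/(nat_of_ord (Ordinal ltxd)) !mem_drop_one_line eq_vw.
by apply/idP/idP => /mem_drop/one_line_ltn; lia.
Qed.

End OneLine.

(** Each half is the complement of the other among the common letters. This trades the values in a
    prefix for those in the remaining suffix. *)
Lemma eq_mem_cat_uniq (T : eqType) (a b a' b' : seq T) :
  uniq (a ++ b) -> uniq (a' ++ b') -> a ++ b =i a' ++ b' ->
  (a =i a' <-> b =i b').
Proof.
move=> Uab Uab' eq_ab.
have disj (c e : seq T) x : uniq (c ++ e) -> ~~ ((x \in c) && (x \in e)).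
  rewrite cat_uniq => /and3P[_ /hasPn ce _].
  by apply/andP => -[xc /ce]; rewrite /= xc.
split=> eq_part x; have := eq_ab x; have := disj _ _ x Uab;
  have := disj _ _ x Uab'; rewrite !mem_cat eq_part;
  do 3 case: (_ \in _) => //=.
Qed.

(** * Occurrences and their overlaps *)

Definition occurrences d (v : 'S_d) k n (u : n.-tuple 'I_k) : {set 'I_n} :=
  [set j : 'I_n | (j + d <= n) &&
     order_iso (take d (drop j (letters u))) (one_line v)].

Lemma occurrencesP d (v : 'S_d) k n (u : n.-tuple 'I_k) (j : 'I_n) :
  reflect (j + d <= n /\ forall p q, p < d -> q < d ->
             (nth 0 (letters u) (j + p) < nth 0 (letters u) (j + q)) =
             (nth 0 (one_line v) p < nth 0 (one_line v) q))
          (j \in occurrences v u).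
Proof.
rewrite inE; apply: (iffP andP) => -[le_jd].
  move=> /order_isoP[-> ov]; split=> // p q ltp ltq.
  by rewrite -ov ?size_one_line // !nth_take // !nth_drop.
move=> ov; split=> //; apply/order_isoP.
have -> : size (take d (drop j (letters u))) = d.
  by rewrite size_take_min size_drop size_map size_tuple; lia.
rewrite size_one_line; split=> // p q ltp ltq.
by rewrite !nth_take // !nth_drop ov.
Qed.

Lemma nth_letters k n (u : n.-tuple 'I_k) (i : 'I_n) :
  nth 0 (letters u) i = tnth u i.
Proof. by rewrite (nth_map (tnth u i)) ?size_tuple // -tnth_nth. Qed.

(** The letters shared by the two windows end the first copy of v and begin the second, so both
    pieces of v have the order of the same stretch of u. For e >= d the pieces are empty. *)
Lemma occurrences_overlap d (v : 'S_d) k n (u : n.-tuple 'I_k) (j j' : 'I_n)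
    (e : nat) :
  j \in occurrences v u -> j' \in occurrences v u -> j' = j + e :> nat ->
  order_iso (take (d - e) (one_line v)) (drop e (one_line v)).
Proof.
move=> /occurrencesP[_ ov] /occurrencesP[_ ov'] j'E; apply/order_isoP.
have -> : size (take (d - e) (one_line v)) = d - e.
  by rewrite size_take_min size_one_line; lia.
rewrite size_drop size_one_line; split=> // p q ltp ltq.
by rewrite !nth_take // !nth_drop -ov' -?ov ?j'E -?addnA //; lia.
Qed.

(** * Gluing the rearrangements of the windows *)

Section Rearrange.

Variables (d : nat) (v w : 'S_d) (n : nat) (S : {set 'I_n}).

Let sigma := transfer (one_line v) (one_line w).
Let tau := transfer (one_line w) (one_line v).

(** The covering window is chosen arbitrarily; [S_compat] makes the value independent of the choice,
    and [S_fits] keeps it below n, so that the default of [insubd] does not arise. *)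
Definition rearrange (x : 'I_n) : 'I_n :=
  if [pick j in S | j <= x < j + d] is Some j
  then insubd x (j + sigma (x - j)) else x.

Let sigma_lt p : p < d -> sigma p < d.
Proof.
have := @transfer_lt _ _ (one_line_uniq v) (one_line_uniq w)
  (one_line_mem v w) p.
by rewrite size_one_line.
Qed.

Let tau_lt p : p < d -> tau p < d.
Proof.
have := @transfer_lt _ _ (one_line_uniq w) (one_line_uniq v)
  (one_line_mem w v) p.
by rewrite size_one_line.
Qed.

Hypothesis S_fits : {in S, forall j : 'I_n, j + d <= n}.
Hypothesis S_compat : {in S &, forall (j j' : 'I_n) e, j' = j + e :> nat ->
  forall p, p + e < d -> sigma (p + e) = sigma p + e}.

Lemma rearrangeE (j x : 'I_n) p :
  j \in S -> p < d -> x = j + p :> nat ->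
  rearrange x = j + sigma p :> nat.
Proof.
move=> Sj ltp xE; rewrite /rearrange; case: pickP => [j'|/(_ j)]; last first.
  by rewrite Sj xE /=; lia.
move=> /and3P[Sj' le_j'x lt_xj'].
have lt_q : x - j' < d by lia.
rewrite insubdK; last first.
  by have := sigma_lt lt_q; have := S_fits Sj'; rewrite -topredE /=; lia.
(* Compatibility applies from the window that starts first to the other one; the shift is the
   distance of their starts. *)
case: (leqP j j') => [le_jj'|lt_j'j].
- have := @S_compat j j' Sj Sj' (j' - j) _ (x - j') _.
  have -> : x - j' + (j' - j) = p by lia.
  by move=> -> //; lia.
- have := @S_compat j' j Sj' Sj (j - j') _ p _.
  have -> : p + (j - j') = x - j' by lia.
  by move=> -> //; lia.
Qed.

(** Surjectivity on positions makes composing a word with [rearrange] injective. *)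
Lemma rearrange_surj (x : 'I_n) : exists y, rearrange y = x.
Proof.
case E: [pick j in S | j <= x < j + d] => [j|]; last by exists x; rewrite /rearrange E.
move: E; case: pickP => // j' /and3P[Sj le_jx lt_xj] [jE]; subst j'.
have ltp : x - j < d by lia.
(* The preimage lies in the same window, at the offset given by [tau], the inverse of [sigma]. *)
have lty : j + tau (x - j) < n.
  by have := tau_lt ltp; have := S_fits Sj; lia.
exists (Ordinal lty); apply: val_inj.
rewrite /= (@rearrangeE j _ (tau (x - j))) ?tau_lt // /sigma /tau transferK ?size_one_line //; first lia.
- exact: one_line_uniq.
- exact: one_line_mem.
Qed.

(** In a window, offset r receives the letter of u at offset [sigma r], whose rank there is v_(sigma
    r) = w_r. *)
Lemma rearrange_occurrences k (u : n.-tuple 'I_k) :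
  S \subset occurrences v u ->
  S \subset occurrences w [tuple tnth u (rearrange i) | i < n].
Proof.
move=> /subsetP SO; apply/subsetP => j Sj; apply/occurrencesP.
have /occurrencesP[le_jd ov] := SO j Sj; split=> // p q ltp ltq.
have nthE r : r < d -> nth 0 (letters [tuple tnth u (rearrange i) | i < n]) (j + r)
    = nth 0 (letters u) (j + sigma r).
  move=> ltr; have ltn_r : j + r < n by lia.
  rewrite -[j + r]/(nat_of_ord (Ordinal ltn_r)) nth_letters tnth_mktuple.
  by rewrite -nth_letters (@rearrangeE j _ r).
have nth_sigma r : r < d -> nth 0 (one_line v) (sigma r) = nth 0 (one_line w) r.
  move=> ltr; apply: nth_transfer; first exact: one_line_mem.
  by rewrite size_one_line.
by rewrite !nthE // ov ?sigma_lt // !nth_sigma.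
Qed.

End Rearrange.

(** * Comparing the counts for v and w *)

Lemma card_occurrences_le d (v w : 'S_d) k n (S : {set 'I_n})
    (hO : overlap_set v = overlap_set w)
    (hsets : forall i : 'I_d, i \in overlap_set v ->
       prefix_values v (d - i) = prefix_values w (d - i) /\
       suffix_values v i = suffix_values w i) :
  #|[set u : n.-tuple 'I_k | S \subset occurrences v u]| <=
  #|[set u : n.-tuple 'I_k | S \subset occurrences w u]|.
Proof.
case: (set_0Vmem [set u : n.-tuple 'I_k | S \subset occurrences v u]).
  by move=> ->; rewrite cards0.
(* One word u0 with v at all of [S] already shows that the windows fit and that their overlaps are
   self-overlaps of v. *)
case=> u0; rewrite inE => /subsetP SO.
have fits : {in S, forall j : 'I_n, j + d <= n}.
  by move=> j /SO/occurrencesP[].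
have compat : {in S &, forall (j j' : 'I_n) e, j' = j + e :> nat ->
    forall p, p + e < d ->
      transfer (one_line v) (one_line w) (p + e) =
      transfer (one_line v) (one_line w) p + e}.
  move=> j j' /SO Oj /SO Oj' e j'E p ltpe.
  have [->|e_gt0] := posnP e; first by rewrite !addn0.
  (* A shift by e > 0 corresponds to the overlap index d - e, the common length of prefix and
     suffix. *)
  have lt_i : d - e < d by lia.
  have dE : d - (d - e) = e by lia.
  have iso_v := occurrences_overlap Oj Oj' j'E.
  have Ov : Ordinal lt_i \in overlap_set v.
    by rewrite inE /= dE iso_v andbT; lia.
  have := Ov; rewrite hO inE /= dE => /andP[_ iso_w].
  have [/= eq_pre eq_suf] := hsets _ Ov; rewrite dE in eq_pre.
  (* At index d - e the hypotheses speak of the first e values and of those from position d - e on;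
     [transfer_shift] needs the two complements. *)
  have cut m : take m (one_line v) =i take m (one_line w) <->
               drop m (one_line v) =i drop m (one_line w).
    apply: eq_mem_cat_uniq; rewrite !cat_take_drop ?one_line_uniq //.
    exact: one_line_mem.
  apply: transfer_shift; rewrite ?size_one_line ?one_line_uniq //.
  - exact: one_line_mem.
  - exact/cut/eq_drop_one_line.
  - exact/cut/eq_take_one_line.
pose f (u : n.-tuple 'I_k) := [tuple tnth u (rearrange v w S i) | i < n].
have f_inj : injective f.
  move=> u u' /(congr1 (@tnth _ _)) eq_f; apply: eq_from_tnth => x.
  have [y <-] := rearrange_surj fits compat x.
  by move: (congr1 (fun h => h y) eq_f); rewrite !tnth_mktuple.
rewrite -(card_imset _ f_inj); apply/subset_leq_card/subsetP => _ /imsetP[u Ou ->].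
by move: Ou; rewrite !inE; apply: rearrange_occurrences.
Qed.

Theorem theorem1 (d : nat) (v w : 'S_d) (hd : 1 <= d)
  (hO : overlap_set v = overlap_set w)
  (hsets : forall i : 'I_d, i \in overlap_set v ->
     prefix_values v (d - i) = prefix_values w (d - i) /\
     suffix_values v i = suffix_values w i) :
  strongly_c_Wilf_equiv v w /\ c_Wilf_equiv v w.
Proof.
suff g_eq k n r : g v k n r = g w k n r by split=> [k n r _ _|k n _ _]; apply: g_eq.
have fib_eq (S : {set 'I_n}) : #|[set u : n.-tuple 'I_k | occurrences v u == S]| =
                        #|[set u : n.-tuple 'I_k | occurrences w u == S]|.
  apply: (eq_card_fibers _ S) => {}S; apply/eqP; rewrite eqn_leq.
  (* The hypotheses are symmetric in v and w, so the inequality holds in both directions. *)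
  by rewrite !card_occurrences_le // => i; rewrite -hO => /hsets[-> ->].
have g_sum (v' : 'S_d) : g v' k n r =
    \sum_(S : {set 'I_n} | #|S| == r)
      #|[set u : n.-tuple 'I_k | occurrences v' u == S]|.
  rewrite /g -sum1_card.
  rewrite (partition_big (@occurrences _ v' k n) (fun S : {set 'I_n} => #|S| == r)) => [|u]; last first.
    by rewrite inE.
  apply: eq_bigr => S /eqP rS; rewrite -sum1_card; apply: eq_bigl => u.
  rewrite !inE; case: (occurrences v' u =P S) => [uS|]; rewrite ?andbF //.
  by rewrite -[con v' u]/#|occurrences v' u| uS rS eqxx.
by rewrite !g_sum; apply: eq_bigr => S _; apply: fib_eq.
Qed.
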